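(* Let $0<\alpha<1$ be given. There is a constant $K$ (independent of the function $\overline u$ below) such that, for every $\overline u\in\mathbf L^1(\mathbb R)\cap\mathbf L^\infty(\mathbb R)$, one has $\overline u\in\mathcal P_\alpha$ if and only if $\overline u$ can be decomposed as $$\overline u(x)=\sum_{k=0}^\infty v_k(x)\qquad\text{for a.e. }x\in\mathbb R,$$ where the functions $v_k:\mathbb R\to\mathbb R$ satisfy the following properties for some finite constant $C\le K\,\|\overline u\|_{\mathcal P_\alpha}$: (i) (bounds on the support and on the total variation) $\mathrm{Tot.Var.}\{v_0\}\le C$ and, for all $k\ge 1$, $$\mathrm{Tot.Var.}\{v_k\}\le C\cdot 2^{(1-\alpha)k},\qquad \mathrm{meas}(\{v_k\ne 0\})\le C\cdot 2^{-\alpha k}.$$ (ii) (one-sided Lipschitz bound) for all $k\ge 0$, $$v_k(x_2)-v_k(x_1)\le 2^k(x_2-x_1)\qquad\text{for all }x_1<x_2.$$ (iii) (a further decomposition) for each $k\ge 1$ one can further decompose $v_k=\sum_{p=1}^\infty v_k^p$ so that: each $v_k^p$ satisfies $v_k^p(x_2)-v_k^p(x_1)\le 2^k(x_2-x_1)$ for all $x_1<x_2$; the supports of the functions $v_k^p$, $p\ge1$, have disjoint interiors; and, setting $\ell_k^p=\mathrm{meas}(\mathrm{supp}\,v_k^p)$, $$|v_k^p(x)|\le h_k^p:=2^k\ell_k^p\quad\text{for all }x\in\mathrm{supp}\,v_k^p,\qquad \sum_{p\ge1}\ell_k^p\le C\cdot 2^{-\alpha k}.$$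
   Context: $\mathrm{Tot.Var.}\{g\}$ is the total variation of $g$ on $\mathbb R$, and $\mathrm{meas}$ is Lebesgue measure. Definition of $\mathcal P_\alpha$ ($0<\alpha<1$). For $\lambda\in\,]0,1]$ and a measurable function $f:\mathbb R\to\mathbb R$, let $d^\lambda(f,0)\in[0,+\infty]$ be the infimum of all $C\ge 0$ for which there exists $\widetilde f\in\mathbf L^1(\mathbb R)$ with $$\mathrm{Tot.Var.}\{\widetilde f\}\le C\lambda^{\alpha-1},\qquad \mathrm{meas}\{x\in\mathbb R:\ f(x)\ne\widetilde f(x)\}\le C\lambda^{\alpha}$$ (with $\inf\emptyset=+\infty$). For $\overline u\in\mathbf L^1(\mathbb R)\cap\mathbf L^\infty(\mathbb R)$ set $\|\overline u\|_{\mathcal P_\alpha}=\sup_{0<\lambda\le 1}d^\lambda(\overline u,0)\in[0,+\infty]$, and write $\overline u\in\mathcal P_\alpha$ if $\|\overline u\|_{\mathcal P_\alpha}<+\infty$ (this is a notation; it is not a norm). *)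

(* Defs.v *)
From HB Require Import structures.
From mathcomp Require Import all_boot all_order all_algebra.
From mathcomp Require Import all_classical all_reals all_analysis.

Set Implicit Arguments.
Unset Strict Implicit.
Unset Printing Implicit Defensive.
Import Order.TTheory GRing.Theory Num.Theory.
Import numFieldNormedType.Exports.

Local Open Scope classical_set_scope.
Local Open Scope ring_scope.

(* [completed_lebesgue_measure] lives on the Caratheodory sigma-algebra, so
   "measurable" below means Lebesgue measurable, not merely Borel. *)
Notation meas := (@completed_lebesgue_measure _).

Definition L1 (R : realType) (f : R -> R) : Prop :=
  f \in Lfun (@completed_lebesgue_measure R) 1%E.

Definition Linfty (R : realType) (f : R -> R) : Prop :=
  f \in Lfun (@completed_lebesgue_measure R) +oo%E.

Definition TotVar (R : realType) (g : R -> R) : \bar R :=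
  ereal_sup [set total_variation ab.1 ab.2 g | ab in [set ab : R * R | ab.1 <= ab.2]].

Definition dlambda (R : realType) (alpha lambda : R) (f : R -> R) : \bar R :=
  ereal_inf [set C%:E | C in [set C : R | 0 <= C /\
    exists ftilde : R -> R,
      [/\ L1 ftilde,
          (TotVar ftilde <= (C * lambda `^ (alpha - 1))%:E)%E &
          (meas [set x | f x <> ftilde x] <= (C * lambda `^ alpha)%:E)%E]]].

Definition Pnorm (R : realType) (alpha : R) (u : R -> R) : \bar R :=
  ereal_sup [set dlambda alpha lambda u | lambda in `]0, 1]].

Definition Pclass (R : realType) (alpha : R) : set (R -> R) :=
  [set u | [/\ L1 u, Linfty u & (Pnorm alpha u < +oo)%E]].

Definition one_sided_lip (R : realType) (L : R) (v : R -> R) : Prop :=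
  forall x1 x2 : R, x1 < x2 -> v x2 - v x1 <= L * (x2 - x1).

Definition supp (R : realType) (v : R -> R) : set R :=
  closure [set x | v x <> 0].

(* The decomposition [v = \sum_(p >= 1) vp p] of a single layer [v = v_k];
   the value of [vp] at [p = 0] is irrelevant. *)
Definition layer_decomposition (R : realType) (alpha C : R) (k : nat)
    (v : R -> R) (vp : nat -> R -> R) : Prop :=
  [/\ forall x, \sum_(1 <= p < n) vp p x @[n --> \oo] --> v x,
      forall p, (1 <= p)%N -> one_sided_lip (2 ^+ k) (vp p),
      trivIset [set p | (1 <= p)%N] (fun p => (supp (vp p))°),
      forall p, (1 <= p)%N -> forall x, supp (vp p) x ->
        (`|vp p x|%:E <= (2 ^+ k)%:E * meas (supp (vp p)))%E &
      (\sum_(1 <= p <oo) meas (supp (vp p))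
        <= (C * 2 `^ (- alpha * k%:R))%:E)%E].

(* Main.v *)
(* If [u] is in the class, let [f_k] be a near-optimal approximation at scale
   [lambda = 2^-k] and [D_0 = f_0], [D_k = f_k - f_(k-1)].  For a slope [L], the
   inf-convolution [lreg L D x = inf_(y <= x) (D y + L (x - y))] satisfies the
   one-sided Lipschitz bound with constant [L], has total variation at most
   [3 TotVar D], and differs from [D] on a set of measure at most
   [3 TotVar D / L], by a rising-sun argument; moreover
   [lreg L' D - lreg L D] is one-sided Lipschitz with constant [L' - L] when
   [L <= L'].  Hence [S_n = sum_(k <= n) lreg L_(k,n) D_k], with [L_(k,n)] a
   multiple of [2^n b^(n-k)] for some [b < 1] close enough to [1], agrees with
   [u] off a set of measure [O(2^(- alpha n))], and the layers are
   [v_0 = S_0] and [v_n = S_n - S_(n-1)].  The pieces [v_k^p] are the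
   restrictions of [v_k] to the connected components of [{v_k <> 0}].
   Conversely, the partial sums of the layers are admissible approximations
   of [u].  If the norm vanishes, then [u = 0] almost everywhere. *)

Require Import Defs.
From HB Require Import structures.
From mathcomp Require Import all_boot all_order all_algebra.
From mathcomp Require Import all_classical all_reals all_analysis.
From mathcomp Require Import measurable_realfun ring lra.

Import Order.TTheory GRing.Theory Num.Theory.
Import numFieldNormedType.Exports.

Set Implicit Arguments.
Unset Strict Implicit.
Unset Printing Implicit Defensive.

Local Open Scope classical_set_scope.
Local Open Scope ring_scope.

(** * Measure and total variation *)

(** [meas] unfolds to the outer measure generated by interval lengths, so monotonicity and
    subadditivity hold for arbitrary sets. *)
Lemma meas_le (R : realType) (A B : set R) :
  A `<=` B -> (meas A <= meas B)%E.
Proof. exact: (@le_outer_measure _ _ (wlength idfun)^*%mu A B). Qed.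

Lemma meas_setU (R : realType) (A B : set R) :
  (meas (A `|` B) <= meas A + meas B)%E.
Proof. exact: (@outer_measureU2 _ _ (wlength idfun)^*%mu A B). Qed.

Lemma meas_tail_geometric (R : realType) (A : (set R)^nat) (C q : R) (m : nat) :
  0 <= C -> 0 < q -> q < 1 ->
  (forall n, (m <= n)%N -> (meas (A n) <= (C * q ^+ n)%:E)%E) ->
  (meas (\bigcup_(n in ~` `I_m) A n) <= (C / (1 - q) * q ^+ m)%:E)%E.
Proof.
move=> C0 q0 q1 hA.
apply: (le_trans
  (@outer_measure_sigma_subadditive_tail _ _ (wlength idfun)^*%mu m A)).
apply: lime_le; first by apply: is_cvg_nneseries => n _ _; exact: measure_ge0.
near=> n.
apply: (@le_trans _ _ (\sum_(m <= i < n) (C * q ^+ i)%:E)%E).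
  by rewrite big_nat [leRHS]big_nat; apply: lee_sum => i /andP[mi _]; exact: hA.
have mn : (m <= n)%N by near: n; exact: nbhs_infty_ge.
rewrite sumEFin lee_fin -mulr_sumr -mulrA ler_wpM2l// mulrC.
rewrite -(subnKC mn) geometric_partial_tail.
by apply: geometric_le_lim => //; rewrite ?exprn_ge0 ?ltW// gtr0_norm.
Unshelve. all: by end_near. Qed.

Lemma meas_null_negligible (R : realType) (N : set R) :
  meas N = 0%E -> (@completed_lebesgue_measure R).-negligible N.
Proof.
move=> /negligible_outer_measure[A [mA A0 NA]].
by exists A; split => //; exact: sub_caratheodory.
Qed.

Lemma negligible_meas_null (R : realType) (N : set R) :
  (@completed_lebesgue_measure R).-negligible N -> meas N = 0%E.
Proof.
move=> [A [mA A0 NA]]; apply/eqP.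
by rewrite eq_le measure_ge0 -[leRHS]A0 meas_le.
Qed.

(** Borel-Cantelli: the exceptional set lies in every tail union, whose measure tends to zero. *)
Lemma ae_eventually_notin (R : realType) (A : (set R)^nat) (C q : R) :
  0 <= C -> 0 < q -> q < 1 ->
  (forall n, (meas (A n) <= (C * q ^+ n)%:E)%E) ->
  {ae @completed_lebesgue_measure R, forall x, \forall n \near \oo, ~ A n x}.
Proof.
move=> C0 q0 q1 hA; apply: meas_null_negligible; apply/eqP.
rewrite eq_le measure_ge0 andbT; apply/lee_addgt0Pr => e e0; rewrite add0e.
have : C / (1 - q) * q ^+ n @[n --> \oo] --> (0 : R).
  rewrite -[X in _ --> X](mulr0 (C / (1 - q))).
  by apply: cvgMr; apply: cvg_expr; rewrite gtr0_norm.
move=> /cvgrPdist_lt /(_ _ e0) [m _ /(_ m (leqnn _))].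
rewrite sub0r normrN => hm.
apply: le_trans (le_trans (meas_tail_geometric C0 q0 q1 (m := m) _) _) => //.
  apply: meas_le => x /= h; apply: contrapT => hx; apply: h.
  exists m => // n /= mn Anx; apply: hx; exists n => //=.
  by apply/negP; rewrite -leqNgt.
by rewrite lee_fin (le_trans (ler_norm _) (ltW hm)).
Qed.

(* [N] plays the role of the variation function [x |-> TotVar of f on ]-oo, x]]. *)
Definition var_dominated (R : realType) (N : R -> R) (T : R) (f : R -> R) :=
  (forall x, 0 <= N x <= T) /\
  forall x y, x <= y -> `|f y - f x| <= N y - N x.

(** Variation is additive over adjacent intervals, so the increment of [E] from [x] to [y] is at
    least the variation on [[x, y]], hence at least [|f y - f x|]. *)
Lemma TotVar_dominated (R : realType) (f : R -> R) (T : R) :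
  (TotVar f <= T%:E)%E -> exists N, var_dominated N T f.
Proof.
move=> fT.
have TV x y : x <= y -> (total_variation x y f <= T%:E)%E.
  by move=> xy; apply: le_trans fT; apply: ereal_sup_ubound; exists (x, y).
pose E x := ereal_sup [set total_variation a x f | a in [set a | a <= x]].
have E0 x : (0 <= E x)%E.
  apply: ereal_sup_ubound; exists x => //=; exact: total_variationxx.
have ET x : (E x <= T%:E)%E by apply: ge_ereal_sup => _ [a /= ax <-]; exact: TV.
have Efin x : E x \is a fin_num.
  by rewrite ge0_fin_numE// (le_lt_trans (ET x))// ltry.
exists (fine \o E); split => [x|x y xy] /=.
  by rewrite -!lee_fin fineK// E0 ET.
rewrite -lee_fin EFinB !fineK// leeBrDr//.
have tvfin : total_variation x y f \is a fin_num.
  rewrite ge0_fin_numE ?total_variation_ge0//.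
  by rewrite (le_lt_trans (TV _ _ xy))// ltry.
apply: (@le_trans _ _ (total_variation x y f + E x)%E).
  by rewrite leeD2r// total_variation_ge.
rewrite -leeBrDl//; apply: ge_ereal_sup => _ [a /= ax <-].
rewrite leeBrDl// addeC -total_variationD//.
by apply: ereal_sup_ubound; exists a => //=; exact: le_trans ax xy.
Qed.

(** Along any partition of [[a, b]] the jumps of [f] are bounded by increments of [N], which
    telescope to [N b - N a <= T]. *)
Lemma dominated_TotVar (R : realType) (f N : R -> R) (T : R) :
  var_dominated N T f -> (TotVar f <= T%:E)%E.
Proof.
move=> [N0T fN]; apply: ge_ereal_sup => _ [[a b] /= ab <-].
apply: ge_ereal_sup => _ [_ [s sab <-] <-]; rewrite lee_fin.
apply: (@le_trans _ _ (N b - N a)); last first.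
  by have /andP[Na _] := N0T a; have /andP[_ Nb] := N0T b; lra.
elim: s a sab {ab} => [a /itv_partition_nil ->|c s ih a].
  by rewrite /variation big_nil subrr.
move=> /[dup] sab /itv_partition_cons /ih {}ih.
rewrite /variation big_nat_recl//=.
have ac : a <= c by case: sab => /= /andP[/ltW].
have := fN _ _ ac; move: ih; rewrite /variation/=; lra.
Qed.

Lemma var_dominatedD (R : realType) (f g N M : R -> R) (S T : R) :
  var_dominated N S f -> var_dominated M T g ->
  var_dominated (N \+ M) (S + T) (f \+ g).
Proof.
move=> [NS fN] [MT gM]; split => [x|x y xy] /=.
  by have := NS x; have := MT x; lra.
rewrite (_ : _ - _ = (f y - f x) + (g y - g x)); last by ring.
by rewrite (le_trans (ler_normD _ _))//; have := fN _ _ xy; have := gM _ _ xy; lra.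
Qed.

Lemma TotVarD (R : realType) (f g : R -> R) (S T : R) :
  (TotVar f <= S%:E)%E -> (TotVar g <= T%:E)%E ->
  (TotVar (f \+ g)%R <= (S + T)%:E)%E.
Proof.
move=> /TotVar_dominated[N fN] /TotVar_dominated[M gM].
exact: dominated_TotVar (var_dominatedD fN gM).
Qed.

Lemma TotVarN (R : realType) (f : R -> R) : TotVar (\- f) = TotVar f.
Proof.
by congr ereal_sup; apply/seteqP; split => _ [x xx <-]; exists x => //;
  rewrite total_variationN.
Qed.

Lemma TotVarB (R : realType) (f g : R -> R) (S T : R) :
  (TotVar f <= S%:E)%E -> (TotVar g <= T%:E)%E ->
  (TotVar (f \- g)%R <= (S + T)%:E)%E.
Proof. by move=> fS gT; apply: TotVarD => //; rewrite TotVarN. Qed.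

Lemma TotVar_cst (R : realType) (c : R) : TotVar (cst c) = 0%E.
Proof.
apply/eqP; rewrite eq_le; apply/andP; split.
  apply: (@dominated_TotVar _ _ (cst 0)); split => [x|x y _] /=.
    by rewrite lexx.
  by rewrite !subrr normr0.
by apply: ereal_sup_ubound; exists (0, 0) => //=; exact: total_variationxx.
Qed.

Lemma TotVar_ge0 (R : realType) (f : R -> R) : (0 <= TotVar f)%E.
Proof. by apply: ereal_sup_ubound; exists (0, 0) => //=; exact: total_variationxx. Qed.

Lemma TotVar_sum (R : realType) (f : nat -> R -> R) (T : nat -> R) n :
  (forall k, (k < n)%N -> (TotVar (f k) <= (T k)%:E)%E) ->
  (TotVar (fun x => \sum_(k < n) f k x)%R <= (\sum_(k < n) T k)%R%:E)%E.
Proof.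
elim: n => [_|n ih fT].
  under eq_fun do rewrite big_ord0.
  by rewrite big_ord0 (TotVar_cst 0).
under eq_fun do rewrite big_ord_recr/=.
rewrite big_ord_recr/=; apply: TotVarD; last exact: fT.
by apply: ih => k kn; apply: fT; exact: ltnW.
Qed.

Lemma TotVar_osc (R : realType) (f : R -> R) (T x y : R) :
  (TotVar f <= T%:E)%E -> `|f x - f y| <= T.
Proof.
move=> /TotVar_dominated[N [NT fN]].
wlog yx : x y / y <= x.
  by move=> h; case: (leP y x) => [/h//|/ltW /h]; rewrite distrC.
by have := fN _ _ yx; have := NT x; have := NT y; lra.
Qed.

(** * One-sided Lipschitz regularization *)

(* The largest function below [f] whose increments satisfy [one_sided_lip L]. *)
Definition lreg (R : realType) (L : R) (f : R -> R) (x : R) : R :=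
  inf [set f y + L * (x - y) | y in [set y | y <= x]].

(** The lower bound [m] makes [inf] a genuine infimum here, not its default value. *)
Lemma lreg_le (R : realType) (L m : R) (f : R -> R) (x y : R) :
  0 <= L -> (forall z, m <= f z) -> y <= x -> lreg L f x <= f y + L * (x - y).
Proof.
move=> L0 mf yx; apply: ge_inf; last by exists y.
exists m => _ [z /= zx <-]; have := mf z.
have : 0 <= L * (x - z) by rewrite mulr_ge0// subr_ge0.
by lra.
Qed.

Lemma lreg_ge (R : realType) (L c : R) (f : R -> R) (x : R) :
  (forall y, y <= x -> c <= f y + L * (x - y)) -> c <= lreg L f x.
Proof.
move=> h; apply: lb_le_inf; first by exists (f x + L * (x - x)); exists x => /=.
by move=> _ [y /= yx <-]; exact: h.
Qed.

Lemma lreg_le_self (R : realType) (L m : R) (f : R -> R) (x : R) :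
  0 <= L -> (forall z, m <= f z) -> lreg L f x <= f x.
Proof. by move=> L0 mf; have := lreg_le L0 mf (lexx x); rewrite subrr mulr0 addr0. Qed.

(** Every competitor [y <= x1] at [x1] also competes at [x2], at the extra cost [L * (x2 - x1)]. *)
Lemma lreg_lip (R : realType) (L m : R) (f : R -> R) :
  0 <= L -> (forall z, m <= f z) -> one_sided_lip L (lreg L f).
Proof.
move=> L0 mf x1 x2 x12; rewrite lerBlDl -lerBlDr.
apply: lreg_ge => y yx; rewrite lerBlDr.
have -> : f y + L * (x1 - y) + L * (x2 - x1) = f y + L * (x2 - y) by ring.
by apply: (lreg_le L0 mf); exact: le_trans yx (ltW x12).
Qed.

Lemma le_lreg (R : realType) (L L' m : R) (f : R -> R) (x : R) :
  0 <= L -> L <= L' -> (forall z, m <= f z) -> lreg L f x <= lreg L' f x.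
Proof.
move=> L0 LL' mf; apply: lreg_ge => y yx.
apply: le_trans (lreg_le L0 mf yx) _.
by rewrite lerD2l ler_wpM2r// subr_ge0.
Qed.

(* Wherever [lreg L f] does not grow with slope exactly [L] it touches [f], and
   there the nonnegative difference [lreg L' f - lreg L f] vanishes. *)
Lemma lregB_lip (R : realType) (L L' m : R) (f : R -> R) :
  0 <= L -> L <= L' -> (forall z, m <= f z) ->
  one_sided_lip (L' - L) (lreg L' f \- lreg L f).
Proof.
move=> L0 LL' mf x1 x2 x12 /=; have L'0 := le_trans L0 LL'.
have w1 := le_lreg x1 L0 LL' mf.
suff : lreg L' f x2 - (lreg L' f x1 - lreg L f x1) - (L' - L) * (x2 - x1)
  <= lreg L f x2 by lra.
(* A competitor [y <= x1] also competes at [x1], and the slope bound of [lreg L' f] concludes. A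
   competitor in []x1, x2]] is tested in [lreg L' f x2], where it costs only [(L' - L) * (x2 - y)]
   more. *)
apply: lreg_ge => y yx2; have [yx1|x1y] := leP y x1.
  by have := lreg_lip L'0 mf x12; have := lreg_le L0 mf yx1; lra.
have := lreg_le L'0 mf yx2.
have : 0 <= (L' - L) * (y - x1) by rewrite mulr_ge0// subr_ge0// ltW.
by lra.
Qed.

Lemma TotVar_lb (R : realType) (f : R -> R) (T : R) :
  (TotVar f <= T%:E)%E -> forall y, f 0 - T <= f y.
Proof. by move=> /(TotVar_osc 0) h y; have := le_trans (ler_norm _) (h y); lra. Qed.

(** From [x] to [y] the regularization drops by at most [N y - N x], so adding [2 * N] yields a
    function whose increments dominate those of [lreg L f] in absolute value. *)
Lemma TotVar_lreg (R : realType) (L T : R) (f : R -> R) :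
  0 <= L -> (TotVar f <= T%:E)%E -> (TotVar (lreg L f) <= (3 * T)%:E)%E.
Proof.
move=> L0 fT; have mf := TotVar_lb fT.
have [N [NT fN]] := TotVar_dominated fT.
have N_mono x y : x <= y -> N x <= N y.
  by move=> xy; rewrite -subr_ge0 (le_trans _ (fN _ _ xy)).
pose m := inf (range f).
have m_le x : m <= f x.
  by apply: ge_inf; [exists (f 0 - T) => _ [z _ <-]|exists x].
have f_le x : f x <= m + T.
  rewrite -lerBlDr; apply: lb_le_inf; first by exists (f 0); exists 0.
  move=> _ [z _ <-].
  by have := le_trans (ler_norm _) (TotVar_osc x z fT); lra.
have negN x y : x <= y -> lreg L f x - (N y - N x) <= lreg L f y.
  move=> xy; apply: lreg_ge => z zy; have [zx|xz] := leP z x.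
    have := lreg_le L0 mf zx; have := N_mono _ _ xy.
    have : 0 <= L * (y - x) by rewrite mulr_ge0// subr_ge0.
    by lra.
  have := fN _ _ (ltW xz); rewrite distrC => /(le_trans (ler_norm _)).
  have := N_mono _ _ zy; have := lreg_le_self x L0 mf.
  have : 0 <= L * (y - z) by rewrite mulr_ge0// subr_ge0.
  by lra.
(* Since [m <= lreg L f <= f <= m + T] and [0 <= N <= T], this function takes values in
   [[0, 3 * T]]. *)
apply: (@dominated_TotVar _ _ (fun x => lreg L f x + 2 * N x - m)).
split => [x|x y xy].
  have /andP[N0 NTx] := NT x.
  have : m <= lreg L f x.
    apply: lreg_ge => y yx; have := m_le y.
    by have : 0 <= L * (x - y) by [rewrite mulr_ge0// subr_ge0]; lra.
  have := f_le x; have := lreg_le_self x L0 mf => h1 h2 h3.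
  by apply/andP; split; lra.
by have := negN _ _ xy; have := N_mono _ _ xy; rewrite ler_norml; lra.
Qed.

(* The images under [N] of disjoint intervals are disjoint subintervals of
   [0, T]. *)
Lemma sum_disjoint_increments (R : realType) (I : choiceType) (s : seq I)
    (a b : I -> R) (N : R -> R) (T : R) :
  (forall x y, x <= y -> N x <= N y) -> (forall x, 0 <= N x <= T) ->
  uniq s -> (forall i, a i <= b i) ->
  trivIset [set` s] (fun i => `]a i, b i[%classic) ->
  \sum_(i <- s) (N (b i) - N (a i)) <= T.
Proof.
move=> N_mono NT us ab ts.
have T0 : 0 <= T by have /andP[] := NT 0; exact: le_trans.
pose J i : set R := `]N (a i), N (b i)[%classic.
have muJ i : lebesgue_measure (J i) = (N (b i) - N (a i))%:E.
  rewrite lebesgue_measure_itv/= lte_fin; case: ifPn => [_|]; first by rewrite EFinB.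
  by rewrite -leNgt => h; have := N_mono _ _ (ab i) => h'; congr EFin; lra.
have tJ : trivIset [set` s] J.
  move=> i j si sj [z []]; rewrite /J/= !in_itv/= => /andP[iz zi] /andP[jz zj].
  have lt x y : N x < N y -> x < y.
    by move=> xy; rewrite ltNge; apply: contraTN xy => /N_mono; rewrite leNgt.
  have ibj := lt _ _ (lt_trans iz zj); have jbi := lt _ _ (lt_trans jz zi).
  have iab := lt _ _ (lt_trans iz zi); have jab := lt _ _ (lt_trans jz zj).
  apply: ts => //; exists ((Num.max (a i) (a j) + Num.min (b i) (b j)) / 2).
  have : Num.max (a i) (a j) < Num.min (b i) (b j).
    by rewrite gt_max !lt_min iab jbi ibj jab.
  have : Num.min (b i) (b j) <= b i by rewrite ge_min lexx.
  have : Num.min (b i) (b j) <= b j by rewrite ge_min lexx orbT.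
  have : a i <= Num.max (a i) (a j) by rewrite le_max lexx.
  have : a j <= Num.max (a i) (a j) by rewrite le_max lexx orbT.
  by move=> *; split => /=; rewrite in_itv/=; apply/andP; split; lra.
rewrite -lee_fin -sumEFin; under eq_bigr do rewrite -muJ.
rewrite fsbig_seq//= -measure_fin_bigcup//; last first.
  by move=> i _; exact: measurable_itv.
apply: (@le_trans _ _ (lebesgue_measure (`[0, T]%classic : set R))).
  apply: meas_le => z [i _]; rewrite /J/= !in_itv/= => /andP[iz zi].
  have /andP[N0 _] := NT (a i); have /andP[_ Nb] := NT (b i).
  by apply/andP; split; lra.
rewrite lebesgue_measure_itv/= lte_fin; case: ifPn => _; last by rewrite lee_fin.
by rewrite oppr0 adde0.
Qed.

Lemma lreg_neqP (R : realType) (L m : R) (f : R -> R) (x : R) :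
  0 <= L -> (forall z, m <= f z) -> lreg L f x <> f x ->
  exists2 y, y < x & f y + L * (x - y) < f x.
Proof.
move=> L0 mf fx; apply: contrapT => h; apply: fx; apply/eqP.
rewrite eq_le (lreg_le_self x L0 mf)/=; apply: lreg_ge => y.
rewrite le_eqVlt => /predU1P[->|yx]; first by rewrite subrr mulr0 addr0.
by rewrite leNgt; apply/negP => hy; apply: h; exists y.
Qed.

(* A rising-sun estimate: [lreg L f x < f x] forces the variation of [f] to
   exceed [L] times the length of some interval around [x]. *)
Lemma meas_lreg_neq (R : realType) (L T : R) (f : R -> R) :
  0 < L -> (TotVar f <= T%:E)%E ->
  (meas [set x | lreg L f x <> f x] <= (3 * T / L)%:E)%E.
Proof.
move=> L0 fT; have mf := TotVar_lb fT.
have [N [NT fN]] := TotVar_dominated fT.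
have N_mono x y : x <= y -> N x <= N y.
  by move=> xy; rewrite -subr_ge0 (le_trans _ (fN _ _ xy)).
set E := [set x | _].
(* Points outside [E] receive a dummy unit ball, because the covering lemma expects a nonempty ball
   at every index. *)
have hcr x : exists cr : R * R, 0 < cr.2 /\ (E x -> ball cr.1 cr.2 x /\
    2 * L * cr.2 <= N (cr.1 + cr.2) - N (cr.1 - cr.2)).
  have [Ex|nEx] := pselect (E x); last by exists (0, 1); split => //= ?.
  have [y yx hy] := lreg_neqP (ltW L0) mf Ex.
  (* The slack at [x], converted to a length: [x] is interior to []y, x + d[], and [L] times the
     length of this interval is exactly [f x - f y]. *)
  pose d := (f x - f y - L * (x - y)) / L.
  have d0 : 0 < d by rewrite divr_gt0//; lra.
  have Ld : L * d = f x - f y - L * (x - y) by rewrite mulrC divfK// gt_eqF.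
  clearbody d.
  exists ((y + (x + d)) / 2, (x + d - y) / 2); split; first by rewrite /=; lra.
  move=> _; split.
    by rewrite /ball/= ltr_norml; apply/andP; split; lra.
  rewrite /=.
  have -> : (y + (x + d)) / 2 + (x + d - y) / 2 = x + d by lra.
  have -> : (y + (x + d)) / 2 - (x + d - y) / 2 = y by lra.
  have := fN _ _ (ltW yx) => /(le_trans (ler_norm _)).
  have : N x <= N (x + d) by apply: N_mono; lra.
  by lra.
pose cr x := sval (cid (hcr x)).
have cr0 x : 0 < (cr x).2 by rewrite /cr; case: cid => ? [].
have crE x : E x -> ball (cr x).1 (cr x).2 x /\
    2 * L * (cr x).2 <= N ((cr x).1 + (cr x).2) - N ((cr x).1 - (cr x).2).
  by rewrite /cr; case: cid => ? [? h] /h.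
pose B x : set R := ball (cr x).1 (cr x).2.
pose U := \bigcup_(x in E) B x.
have oU : open U by apply: bigcup_open => x _; exact: ball_open.
apply: (@le_trans _ _ (meas U)).
  by apply: meas_le => x Ex; exists x => //; have [] := crE _ Ex.
(* Inner regularity reduces [U] to a compact [K]. The finite Vitali lemma then selects disjoint
   balls whose threefold dilations cover [K], whence the factor [3]. *)
rewrite -[meas U]/(lebesgue_measure U) lebesgue_regularity_inner_sup; last first.
  exact: open_measurable.
apply: ge_ereal_sup => _ [K [cK KU] <-].
have [D DE KD] : finite_subset_cover E B K.
  move: cK; rewrite compact_cover; apply => // x _; exact: ball_open.
have is_ballB x : is_ball (B x) by exact: is_ball_ball.
have Bn0 x : B x !=set0 by exists (cr x).1; exact: ballxx.
have [F [uF FD tF DF]] := @vitali_lemma_finite_cover _ _ B is_ballB Bn0 (finmap.enum_fset D).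
have KF : K `<=` classical_sets.cover [set` F] (scale_ball 3%:R \o B).
  by apply: subset_trans DF; apply: (subset_trans KD) => x [i Di] ix; exists i.
apply: (@le_trans _ _ (\sum_(i <- F) (3 * (cr i).2 *+ 2)%:E)%E).
  apply: (le_trans (@content_subadditive _ _ _ lebesgue_measure K
    (fun i => 3 *` B (nth 0 F i)) (size F) _ _ _)) => //.
  - by move=> k ?; rewrite scale_ballE//; exact: measurable_ball.
  - exact: compact_measurable.
  - by apply: (subset_trans KF); rewrite /classical_sets.cover bigcup_seq (big_nth 0)//= big_mkord.
  - rewrite (big_nth 0) big_mkord; apply: lee_sum => i _.
    rewrite scale_ballE// le_eqVlt; apply/orP; left; apply/eqP.
    by apply: lebesgue_measure_ball; rewrite mulr_ge0// ltW.
rewrite sumEFin lee_fin ler_pdivlMr// mulr_suml.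
apply: (@le_trans _ _ (3 * \sum_(i <- F)
    (N ((cr i).1 + (cr i).2) - N ((cr i).1 - (cr i).2)))).
  rewrite mulr_sumr big_seq [leRHS]big_seq; apply: ler_sum => i /FD /DE /set_mem Ei.
  by have [_ h] := crE _ Ei; rewrite mulr2n; lra.
rewrite ler_wpM2l//; apply: (@sum_disjoint_increments _ _ F (fun i => (cr i).1 - (cr i).2)
  (fun i => (cr i).1 + (cr i).2) _ _ N_mono NT uF) => [i|].
  by have := cr0 i; lra.
suff -> : (fun i => `](cr i).1 - (cr i).2, (cr i).1 + (cr i).2[%classic) = B by [].
by apply/funext => i; rewrite /B ball_itv.
Qed.

(** * Regularized partial sums and geometric scales *)

Lemma one_sided_lipW (R : realType) (L L' : R) (f : R -> R) :
  L <= L' -> one_sided_lip L f -> one_sided_lip L' f.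
Proof.
move=> LL' fL x1 x2 x12; apply: le_trans (fL _ _ x12) _.
by rewrite ler_wpM2r// subr_ge0 ltW.
Qed.

Lemma one_sided_lipD (R : realType) (L L' : R) (f g : R -> R) :
  one_sided_lip L f -> one_sided_lip L' g -> one_sided_lip (L + L') (f \+ g).
Proof.
by move=> fL gL x1 x2 x12 /=; have := fL _ _ x12; have := gL _ _ x12; lra.
Qed.

Lemma one_sided_lip_sum (R : realType) (L : nat -> R) (f : nat -> R -> R) n :
  (forall k, (k < n)%N -> one_sided_lip (L k) (f k)) ->
  one_sided_lip (\sum_(k < n) L k) (fun x => \sum_(k < n) f k x).
Proof.
elim: n => [_|n ih h]; first by move=> x1 x2 _; rewrite !big_ord0 subrr mul0r.
rewrite (_ : (fun _ => _) = (fun x => \sum_(k < n) f k x) \+ f n); last first.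
  by apply/funext => x; rewrite big_ord_recr.
rewrite big_ord_recr/=; apply: one_sided_lipD; last exact: h.
by apply: ih => k kn; apply: h; exact: ltnW.
Qed.

Lemma meas_bigcup_ltn (R : realType) (A : nat -> set R) (a : nat -> R) n :
  (forall k, (k < n)%N -> (meas (A k) <= (a k)%:E)%E) ->
  (meas [set x | exists2 k, (k < n)%N & A k x] <= (\sum_(k < n) a k)%R%:E)%E.
Proof.
elim: n => [_|n ih h].
  rewrite big_ord0 (_ : mkset _ = set0) ?measure0//.
  by apply/seteqP; split => // x [].
rewrite big_ord_recr/= EFinD.
apply: le_trans (leeD (ih (fun k kn => h k (ltnW kn))) (h n (ltnSn n))).
apply: le_trans (meas_setU _ _); apply: meas_le => x [k].
rewrite ltnS leq_eqVlt => /predU1P[->|kn] Akx; [by right|left].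
by exists k.
Qed.

Lemma sum_expr_le (R : realType) (p : R) n :
  1 < p -> \sum_(k < n.+1) p ^+ k <= p / (p - 1) * p ^+ n.
Proof.
move=> p1; elim: n => [|n ih].
  by rewrite big_ord1 mulr1 expr0 ler_pdivlMr ?mul1r; lra.
rewrite big_ord_recr/=; apply: le_trans (lerD ih (lexx _)) _.
rewrite le_eqVlt; apply/orP; left; apply/eqP; rewrite exprS; field.
by rewrite subr_eq0 gt_eqF.
Qed.

Lemma sum_expr_rev_le (R : realType) (r : R) n :
  0 < r -> r < 1 -> \sum_(k < n.+1) r ^+ (n - k) <= (1 - r)^-1.
Proof.
move=> r0 r1; rewrite (reindex_inj rev_ord_inj)/=.
under eq_bigr => i _ do rewrite subSS subKn ?leq_ord//.
rewrite -(big_mkord xpredT (fun i => r ^+ i)).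
have := @geometric_le_lim R n.+1 1 r ler01 r0; rewrite gtr0_norm// => /(_ r1).
by rewrite mul1r; apply: le_trans; rewrite /series/=; apply: ler_sum => i _; rewrite mul1r.
Qed.

(** In the application [p] is [2 ^ (1 - alpha)] and [q] is [2 ^ (- alpha)]. The condition [b < 1]
    makes the slopes summable over [k <= n], while [1 < p * b] makes the exceptional sets
    summable. *)
Lemma one_sided_partial_sums (R : realType) (p q b M : R) (u : R -> R)
    (f : nat -> R -> R) :
  1 < p -> p = 2 * q -> q < 1 -> 0 < b -> b < 1 -> 1 < p * b -> 0 <= M ->
  (forall k, (TotVar (f k) <= (M * p ^+ k)%:E)%E) ->
  (forall k, (meas [set x | u x <> f k x] <= (M * q ^+ k)%:E)%E) ->
  exists S : nat -> R -> R,
    [/\ forall n, (TotVar (S n) <= (6 * p / (p - 1) * M * p ^+ n)%:E)%E,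
        forall n, (meas [set x | u x <> S n x] <=
          ((1 + 6 / ((1 - b) * (1 - (p * b)^-1))) * M * q ^+ n)%:E)%E,
        one_sided_lip 1 (S 0%N) &
        forall n, one_sided_lip (2 ^+ n.+1) (S n.+1 \- S n)].
Proof.
move=> p1 pq q1 b0 b1 pb1 M0 TVf mf.
have q0 : 0 < q by lra.
pose c := 1 - b; have c0 : 0 < c by rewrite subr_gt0.
pose D k := f k \- (if k is k'.+1 then f k' else cst 0).
have sumD n x : \sum_(k < n.+1) D k x = f n x.
  elim: n => [|n ih]; first by rewrite big_ord1 /D/= subr0.
  by rewrite big_ord_recr/= ih /D/= addrC subrK.
have TVD k : (TotVar (D k) <= (2 * M * p ^+ k)%:E)%E.
  rewrite -mulrA mulr2n mulrDl mul1r; apply: TotVarB => //.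
  have Mp m : 0 <= M * p ^+ m by rewrite mulr_ge0// exprn_ge0// ltW// (lt_trans _ p1).
  case: k => [|k]; first by rewrite TotVar_cst lee_fin.
  apply: le_trans (TVf k) _; rewrite lee_fin exprS mulrCA.
  by apply: ler_peMl => //; exact: ltW.
(* The slopes [L k n] sum to at most [2 ^+ n] over [k <= n], whereas
   [TotVar (D k) / L k n] is bounded by [q ^+ n] times a geometric sequence
   in [n - k]. *)
pose L k n := c * 2 ^+ n * b ^+ (n - k).
have L0 k n : 0 < L k n by rewrite !mulr_gt0// ?exprn_gt0.
(* Raising [n] multiplies the slope by [2 * b >= p * b > 1]; this monotonicity is what [lregB_lip]
   requires. *)
have LS k n : (k <= n)%N -> L k n <= L k n.+1.
  move=> kn; rewrite /L subSn// !exprS.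
  rewrite (_ : c * (2 * 2 ^+ n) * (b * b ^+ (n - k)) =
               2 * b * (c * 2 ^+ n * b ^+ (n - k))); last by ring.
  apply: ler_peMl; first exact: ltW (L0 k n).
  have : p * b <= 2 * b by rewrite ler_wpM2r; lra.
  by lra.
have mD k := TotVar_lb (TVD k).
pose S n x := \sum_(k < n.+1) lreg (L k n) (D k) x.
exists S; split => [n|n||n].
- apply: le_trans (TotVar_sum (fun k _ => TotVar_lreg (ltW (L0 k n)) (TVD k))) _.
  rewrite lee_fin; under eq_bigr do rewrite !mulrA.
  rewrite -mulr_sumr.
  rewrite (_ : _ * p ^+ n = 3 * 2 * M * (p / (p - 1) * p ^+ n)); last by field; lra.
  by rewrite ler_wpM2l ?sum_expr_le// mulr_ge0.
(* Off these sets [S n] equals the telescoping sum of the [D k], that is [f n]. *)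
- pose A k := [set x | lreg (L k n) (D k) x <> D k x].
  apply: (@le_trans _ _ (meas ([set x | u x <> f n x] `|`
      [set x | exists2 k, (k < n.+1)%N & A k x]))).
    apply: meas_le => x /= uS; apply: contrapT => /not_orP[/contrapT uf h].
    apply: uS; rewrite uf -sumD; apply: eq_bigr => k _.
    by apply: contrapT => e; apply: h; exists k => //; exact: nesym.
  apply: le_trans (meas_setU _ _) _.
  rewrite mulrDl mulrDl mul1r EFinD leeD//.
  apply: le_trans (meas_bigcup_ltn
    (fun k _ => meas_lreg_neq (L0 k n) (TVD k))) _.
  rewrite lee_fin.
  (* By [p = 2 * q], the quotient [p ^+ k / (2 ^+ n * b ^+ (n - k))] equals
     [q ^+ n * (p * b)^-1 ^+ (n - k)]. *)
  rewrite (eq_bigr (fun k : 'I_n.+1 =>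
    6 * M / c * q ^+ n * (p * b)^-1 ^+ (n - k))); last first.
    move=> k _; rewrite /L pq exprVn !exprMn.
    have nk : (k <= n)%N by rewrite -ltnS.
    have e x : x ^+ n = x ^+ (n - k) * x ^+ k :> R by rewrite -exprD subnK.
    by rewrite (e 2) (e q); field; rewrite !gt_eqF//= exprn_gt0.
  rewrite -mulr_sumr.
  rewrite (_ : 6 / _ * M * q ^+ n = 6 * M / c * q ^+ n * (1 - (p * b)^-1)^-1).
    apply: ler_wpM2l.
      by rewrite !mulr_ge0 ?invr_ge0 ?exprn_ge0// ltW.
    by apply: sum_expr_rev_le; rewrite ?invr_gt0 ?invf_lt1//; lra.
  by rewrite invfM/=; ring.
- move=> x1 x2 x12; rewrite /S !big_ord1.
  apply: (one_sided_lipW _ (lreg_lip (ltW (L0 0 0)%N) (mD 0%N))) => //.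
  by rewrite /L subn0 !expr0 !mulr1 /c; lra.
(* Passing from [S n] to [S n.+1] steepens the regularizations of the old [D k] and adds one new
   term. *)
- rewrite (_ : _ \- _ = (fun x => \sum_(k < n.+1)
      (lreg (L k n.+1) (D k) \- lreg (L k n) (D k)) x)
      \+ lreg (L n.+1 n.+1) (D n.+1)); last first.
    by apply/funext => x; rewrite /S/= big_ord_recr/= sumrB addrAC.
  have lipB k : (k < n.+1)%N -> one_sided_lip (L k n.+1 - L k n)
      (lreg (L k n.+1) (D k) \- lreg (L k n) (D k)).
    by move=> kn; apply: lregB_lip (ltW (L0 k n)) (LS k n kn) (mD k).
  apply: one_sided_lipW (one_sided_lipD (one_sided_lip_sum lipB)
    (lreg_lip (ltW (L0 n.+1 n.+1)) (mD n.+1))).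
  (* Dropping the subtracted slopes leaves a geometric sum, which the factor [c = 1 - b] normalizes
     to at most [2 ^+ n.+1]. *)
  apply: (@le_trans _ _ (\sum_(k < n.+2) L k n.+1)).
    rewrite [leRHS]big_ord_recr/= lerD2r; apply: ler_sum => k _.
    by rewrite lerBlDr lerDl ltW.
  rewrite -mulr_sumr; have := sum_expr_rev_le n.+1 b0 b1.
  rewrite -(ler_pM2l c0) divff ?gt_eqF// => h.
  have : 0 <= (2 : R) ^+ n.+1 by rewrite exprn_ge0.
  by move=> /ler_wpM2l/(_ _ _ h); rewrite mulr1 mulrCA mulrA.
Qed.

(** * Decomposition along connected components *)

(** A point interior to the closure has points of [I] on both sides, so convexity puts it in [I].
    Disjoint intervals thus give supports with disjoint interiors. *)
Lemma interior_closure_itv (R : realType) (I : set R) :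
  is_interval I -> (closure I)° `<=` I.
Proof.
move=> itvI z; rewrite /interior /= => /nbhs_ballP[e /= e0 zI].
have near_pt c : `|z - c| < e / 2 -> exists2 x, I x & `|c - x| < e / 4.
  move=> zc; have : closure I c by apply: zI; rewrite /ball/=; lra.
  move=> /(_ (ball c (e / 4))) [|x [Ix cx]]; last by exists x.
  by apply: nbhsx_ballx; lra.
have [|x Ix] := near_pt (z - e / 3).
  by rewrite opprB addrC subrK gtr0_norm; lra.
have [|y Iy] := near_pt (z + e / 3).
  by rewrite opprD addNKr normrN gtr0_norm; lra.
rewrite !ltr_norml => /andP[h1 h2] /andP[h3 h4].
by apply: (itvI x y) => //; apply/andP; split; lra.
Qed.

(** Finite measure makes a nonempty interval bounded; it then contains []inf I, sup I[], and its
    closure lies in [[inf I, sup I]]. *)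
Lemma meas_closure_itv (R : realType) (I : set R) :
  is_interval I -> (meas I < +oo)%E -> meas (closure I) = meas I.
Proof.
move=> itvI Ioo; apply/eqP; rewrite eq_le; apply/andP; split; last first.
  by apply: meas_le; exact: subset_closure.
have [->|/set0P[x0 Ix0]] := eqVneq I set0; first by rewrite closure0.
have Ifin : meas I \is a fin_num by rewrite ge0_fin_numE// measure_ge0.
have lenI x y : I x -> I y -> y - x <= fine (meas I).
  move=> Ix Iy; have [xy|yx] := ltP x y; last first.
    rewrite (@le_trans _ _ 0)// ?subr_le0// -lee_fin fineK// measure_ge0.
  rewrite -lee_fin fineK// (_ : (y - x)%:E = lebesgue_measure (`[x, y]%classic : set R)).
    by apply: meas_le => z /=; rewrite in_itv/=; exact: itvI.
  by rewrite lebesgue_measure_itv/= lte_fin xy EFinB.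
have lbI : has_lbound I.
  by exists (x0 - fine (meas I)) => x Ix; have := lenI _ _ Ix Ix0; lra.
have ubI : has_ubound I.
  by exists (x0 + fine (meas I)) => x Ix; have := lenI _ _ Ix0 Ix; lra.
have clI : closure I `<=` `[inf I, sup I]%classic.
  have /closure_id -> : closed (`[inf I, sup I]%classic : set R).
    exact: interval_closed.
  apply: closure_subset => x Ix /=; rewrite in_itv/=.
  by rewrite ge_inf//= ub_le_sup.
have oI : `]inf I, sup I[%classic `<=` I.
  move=> z /=; rewrite in_itv/= => /andP[az zb].
  have [x Ix xz] := inf_lt (ex_intro _ _ Ix0) az.
  have [y Iy zy] := sup_gt (ex_intro _ _ Ix0) zb.
  by apply: (itvI x y) => //; rewrite !ltW.
apply: le_trans (meas_le clI) (le_trans _ (meas_le oI)).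
rewrite -[leLHS]/(lebesgue_measure (`[inf I, sup I]%classic : set R)).
rewrite -[leRHS]/(lebesgue_measure (`]inf I, sup I[%classic : set R)).
by rewrite !lebesgue_measure_itv.
Qed.

(** This relation is reflexive exactly where [v] is nonzero; its classes are the connected
    components of [{v <> 0}]. *)
Definition same_component (R : realType) (v : R -> R) (x y : R) :=
  forall z, x <= z <= y \/ y <= z <= x -> v z <> 0.

Lemma same_component_sym (R : realType) (v : R -> R) (x y : R) :
  same_component v x y -> same_component v y x.
Proof. by move=> h z /or_comm; exact: h. Qed.

Lemma same_component_trans (R : realType) (v : R -> R) (x y z : R) :
  same_component v x y -> same_component v y z -> same_component v x z.
Proof.
move=> xy yz w hw; have [wy|yw] := leP w y.
  case: hw => /andP[h1 h2]; first by apply: xy; left; rewrite h1.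
  by apply: yz; right; rewrite h1.
case: hw => /andP[h1 h2]; first by apply: yz; left; rewrite h2 ltW.
by apply: xy; right; rewrite h2 ltW.
Qed.

Lemma same_component_itv (R : realType) (v : R -> R) (x : R) :
  is_interval [set y | same_component v x y].
Proof.
move=> y z /= xy xz w /andP[yw wz] t [] /andP[h1 h2].
  by apply: xz; left; rewrite h1 (le_trans h2).
by apply: xy; right; rewrite h2 (le_trans yw).
Qed.

(** Read leftwards, the one-sided bound says [v w >= v x - L * (x - w)]: a positive value persists
    to the left over the length [v x / L]. Negative values persist to the right in the same way. *)
Lemma same_component_pos (R : realType) (v : R -> R) (L x z : R) :
  0 <= L -> one_sided_lip L v -> z <= x -> L * (x - z) < v x ->
  same_component v x z.
Proof.
move=> L0 vL zx hx; suff h w : z <= w <= x -> 0 < v w.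
  move=> w [/andP[h1 h2]|hw]; apply/eqP; rewrite gt_eqF// h//.
  by rewrite (le_trans zx h1) (le_trans h2 zx).
move=> /andP[zw]; have zwL : L * (x - w) <= L * (x - z) by rewrite ler_wpM2l// lerB.
rewrite le_eqVlt => /predU1P[->|/vL]; last by lra.
by apply: le_lt_trans hx; rewrite mulr_ge0// subr_ge0.
Qed.

Lemma same_component_neg (R : realType) (v : R -> R) (L x z : R) :
  0 <= L -> one_sided_lip L v -> x <= z -> L * (z - x) < - v x ->
  same_component v x z.
Proof.
move=> L0 vL xz hx; suff h w : x <= w <= z -> v w < 0.
  move=> w [hw|/andP[h1 h2]]; apply/eqP; rewrite lt_eqF// h//.
  by rewrite (le_trans xz h1) (le_trans h2 xz).
move=> /andP[]; rewrite le_eqVlt => /predU1P[<- _|xw wz].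
  by rewrite -oppr_gt0; apply: le_lt_trans hx; rewrite mulr_ge0// subr_ge0.
have : L * (w - x) <= L * (z - x) by rewrite ler_wpM2l// lerB.
by have := vL _ _ xw; lra.
Qed.

(** Although [v] may jump, each component contains an interval of positive length, so there are only
    countably many. *)
Lemma same_component_rat (R : realType) (v : R -> R) (L x : R) :
  0 < L -> one_sided_lip L v -> v x <> 0 ->
  exists r : rat, same_component v x (ratr r).
Proof.
move=> L0 vL /eqP; rewrite neq_lt => /orP[vx|vx].
  have /rat_in_itvoo[r] : x < x - v x / L.
    by rewrite ltrDl oppr_gt0 pmulr_llt0// invr_gt0.
  rewrite in_itv/= => /andP[xr rx]; exists r.
  apply: (same_component_neg (ltW L0) vL (ltW xr)).
  by rewrite mulrC -ltr_pdivlMr//; lra.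
have /rat_in_itvoo[r] : x - v x / L < x by rewrite ltrBlDr ltrDl divr_gt0.
rewrite in_itv/= => /andP[xr rx]; exists r.
apply: (same_component_pos (ltW L0) vL (ltW rx)).
by rewrite mulrC -ltr_pdivlMr//; lra.
Qed.

(* A one-sided Lipschitz bound forces the component of [{v <> 0}] through [x] to
   contain an interval of length [`|v x| / L] with endpoint [x], whence the
   height bound; cutting [v] off outside a component keeps the one-sided
   bound. *)
Lemma component_decomposition (R : realType) (L : R) (v : R -> R) :
  0 < L -> one_sided_lip L v -> (meas [set x | v x <> 0%R] < +oo)%E ->
  exists vp : nat -> R -> R,
  [/\ forall x, \sum_(1 <= p < n) vp p x @[n --> \oo] --> v x,
      forall p, one_sided_lip L (vp p),
      trivIset [set p | (1 <= p)%N] (fun p => (supp (vp p))°),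
      forall p x, (`|vp p x|%:E <= L%:E * meas (supp (vp p)))%E &
      (\sum_(1 <= p <oo) meas (supp (vp p)) <= meas [set x | v x <> 0%R])%E].
Proof.
move=> L0 vL Moo.
(* Indices that decode to no rational give [0]; repetitions are harmless since only the first index
   meeting a component is kept. *)
pose q n : R := if unpickle n is Some r then ratr r else 0.
(* Each component is listed once, at the index of the first rational of the
   enumeration that it contains. *)
pose I n := [set y | same_component v (q n) y /\
  forall j, (j < n)%N -> ~ same_component v (q j) y].
have I_closed n x y : I n x -> same_component v x y -> I n y.
  move=> [nx nj] xy; split => [|j jn jy]; first exact: same_component_trans xy.
  by apply: (nj j jn); exact: same_component_trans jy (same_component_sym xy).
have I_conn n x y : I n x -> I n y -> same_component v x y.
  by move=> [nx _] [ny _]; exact: same_component_trans (same_component_sym nx) ny.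
have I_itv n : is_interval (I n).
  move=> x y Ix Iy z xzy; apply: (I_closed _ _ _ Ix).
  exact: (same_component_itv (I_conn _ _ _ Ix Ix) (I_conn _ _ _ Ix Iy) xzy).
have I_neq0 n x : I n x -> v x <> 0.
  by move=> Ix; apply: (I_conn _ _ _ Ix Ix); left; rewrite lexx.
have I_inj n m x : I n x -> I m x -> n = m.
  move=> [nx nj] [mx mj]; case: (ltngtP n m) => nm //; first by case: (mj _ nm).
  by case: (nj _ nm).
have I_cover x : v x <> 0 -> exists n, I n x.
  move=> /(same_component_rat L0 vL)[r xr].
  have ex : exists n, `[< same_component v (q n) x >].
    exists (pickle r); apply/asboolP.
    by rewrite /q pickleK; exact: same_component_sym.
  exists (ex_minn ex); case: ex_minnP => n /asboolP nx nmin; split => // j jn.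
  by move=> /asboolP /nmin; rewrite leqNgt jn.
pose w n x := if `[< I n x >] then v x else 0.
have w_in n x : I n x -> w n x = v x by move=> Ix; rewrite /w asboolT.
have w_out n x : ~ I n x -> w n x = 0 by move=> Ix; rewrite /w asboolF.
have suppw n : supp (w n) = closure (I n).
  congr closure; apply/seteqP; split => x /=.
    by move=> wx; apply: contrapT => /w_out.
  by move=> Ix; rewrite w_in//; exact: I_neq0 Ix.
have Ioo n : (meas (I n) < +oo)%E.
  by apply: le_lt_trans Moo; apply: meas_le => x; exact: I_neq0.
(* The pieces are numbered from [1] and the components from [0]. *)
exists (fun p => w p.-1); split.
- move=> x; have [vx|/I_cover[n Ix]] := pselect (v x = 0).
    rewrite vx; apply: cvg_near_cst; apply: nearW => n; rewrite big1_seq// => i _.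
    by apply: w_out => /I_neq0; rewrite vx.
  apply: cvg_near_cst.
  exists n.+2 => // m /= nm; rewrite (@big_cat_nat _ _ _ n.+1)//=; last exact: ltnW.
  rewrite big_nat big1 => [|i /andP[i1 iN]]; last first.
    apply: w_out => Ii; move: iN; rewrite -(prednK i1) (I_inj _ _ _ Ii Ix).
    by rewrite ltnn.
  rewrite (@big_ltn _ _ _ n.+1)//= big_nat big1 ?addr0 ?add0r ?w_in//.
  move=> i /andP[ni _]; apply: w_out => Ii.
  by move: ni; rewrite -(I_inj _ _ _ Ii Ix); case: (i) => //= ?; rewrite ltnn.
(* If just one endpoint lies in the component, a violation of the bound would make the sign of [v]
   persist up to the other endpoint, placing it in the same component. *)
- move=> p x1 x2 x12; have L12 : 0 <= L * (x2 - x1).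
    by rewrite mulr_ge0 ?subr_ge0// ltW.
  have [I1|I1] := pselect (I p.-1 x1); have [I2|I2] := pselect (I p.-1 x2).
  + by rewrite !w_in//; exact: vL.
  + rewrite (w_in _ _ I1) (w_out _ _ I2) sub0r leNgt; apply/negP => h; apply: I2.
    exact: I_closed I1 (same_component_neg (ltW L0) vL (ltW x12) h).
  + rewrite (w_out _ _ I1) (w_in _ _ I2) subr0 leNgt; apply/negP => h; apply: I1.
    exact: I_closed I2 (same_component_pos (ltW L0) vL (ltW x12) h).
  + by rewrite !w_out// subrr.
- move=> i j /= i1 j1 [x []]; rewrite !suppw.
  move=> /(interior_closure_itv (I_itv _)) Ii /(interior_closure_itv (I_itv _)) Ij.
  by rewrite -(prednK i1) -(prednK j1) (I_inj _ _ _ Ii Ij).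
- move=> p x; rewrite suppw meas_closure_itv//.
  have [Ix|Ix] := pselect (I p.-1 x); last first.
    by rewrite w_out// normr0 mule_ge0// ?measure_ge0// lee_fin ltW.
  rewrite w_in// -lee_pdivrMl//.
  have [vx|vx] := leP 0 (v x).
    rewrite ger0_norm//; apply: (@le_trans _ _ (meas `]x - v x / L, x]%classic)).
      rewrite -[leRHS]/(lebesgue_measure (`]x - v x / L, x]%classic : set R)).
      rewrite lebesgue_measure_itv/= lte_fin; case: ifPn => [_|].
        by rewrite -EFinB lee_fin; lra.
      by rewrite -leNgt lee_fin; lra.
    apply: meas_le => z /=; rewrite in_itv/= => /andP[xz zx].
    apply: I_closed Ix (same_component_pos (ltW L0) vL zx _).
    by rewrite mulrC -ltr_pdivlMr//; lra.
  rewrite ltr0_norm//; apply: (@le_trans _ _ (meas `[x, x - v x / L[%classic)).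
    rewrite -[leRHS]/(lebesgue_measure (`[x, x - v x / L[%classic : set R)).
    rewrite lebesgue_measure_itv/= lte_fin; case: ifPn => [_|].
      by rewrite -EFinB lee_fin; lra.
    by rewrite -leNgt lee_fin; lra.
  apply: meas_le => z /=; rewrite in_itv/= => /andP[xz zx].
  apply: I_closed Ix (same_component_neg (ltW L0) vL xz _).
  by rewrite mulrC -ltr_pdivlMr//; lra.
- apply: lime_le; first by apply: is_cvg_nneseries => n _ _; exact: measure_ge0.
  apply: nearW => n; rewrite big_add1 big_mkord/=.
  (* Closures add no measure, so additivity can be used on the disjoint intervals [I i]
     themselves. *)
  under eq_bigr do rewrite suppw meas_closure_itv//.
  rewrite -[leLHS]/(\sum_(i < n.-1) lebesgue_measure (I i))%E -measure_bigsetU.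
  + by apply: meas_le; rewrite -bigcup_mkord => x [i _]; exact: I_neq0.
  + by move=> i; exact: is_interval_measurable.
  + by move=> i j _ _ [x [Ii Ij]]; exact: I_inj Ii Ij.
Qed.

(** * Integrability of the approximations *)

(** [|s|] is dominated by [|u| + B * \1_E], with [E = {u <> s}] measurable and of finite measure. *)
Lemma integrable_perturbation d (T : measurableType d) (R : realType)
    (mu : {measure set T -> \bar R}) (u s : T -> R) (B : R) :
  mu.-integrable setT (EFin \o u) -> measurable_fun setT s ->
  (forall x, `|s x| <= B) -> (mu [set x | u x <> s x] < +oo)%E ->
  mu.-integrable setT (EFin \o s).
Proof.
move=> iu ms sB; set E := [set x | _] => Eoo.
have mu_ : measurable_fun setT u by apply/measurable_EFinP; exact: measurable_int iu.
have mE : measurable E.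
  rewrite (_ : E = ~` (setT `&` (u \- s) @^-1` [set 0])).
    by apply: measurableC; apply: measurable_funB => //; exact: measurableT.
  rewrite setTI; apply/seteqP; split => x /=; last by move=> h us; apply: h; rewrite us subrr.
  by move=> h /eqP; rewrite subr_eq0 => /eqP.
have iE : mu.-integrable setT (fun x => (\1_E x)%:E).
  apply/integrableP; split; first exact/measurable_EFinP.
  under eq_integral do rewrite gee0_abs ?lee_fin//.
  by rewrite integral_indic// setIT.
have iD : mu.-integrable setT
    ((abse \o (EFin \o u)) \+ (fun x => B%:E * (\1_E x)%:E))%E.
  by apply: integrableD => //; [exact: integrable_abse|exact: integrableZl].
apply: le_integrable iD => //; first exact/measurable_EFinP.
move=> x _; rewrite lee_fin/=.
have B0 : 0 <= B by rewrite (le_trans _ (sB x)).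
rewrite [leRHS]ger0_norm ?addr_ge0 ?mulr_ge0//.
have [us|us] := pselect (u x = s x); first by rewrite us lerDl mulr_ge0.
by rewrite indicE mem_set// mulr1; apply: le_trans (sB x) _; rewrite lerDr.
Qed.

Lemma integrable_not_bounded_below d (T : measurableType d) (R : realType)
    (mu : {measure set T -> \bar R}) (f : T -> R) (c : R) :
  mu setT = +oo%E -> mu.-integrable setT (EFin \o f) -> 0 < c ->
  ~ (forall x, c <= `|f x|).
Proof.
move=> muT /integrableP[mf foo] c0 cf.
have : (\int[mu]_x (cst c%:E x) <= \int[mu]_x `|(EFin \o f) x|)%E.
  apply: ge0_le_integral => //; first by move=> x _; rewrite lee_fin ltW.
    by apply: measurableT_comp.
  by move=> x _; rewrite /= lee_fin.
by rewrite integral_cst// muT gt0_muley// leye_eq => /eqP e; rewrite e in foo.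
Qed.

(** Subtracting [L * x] leaves a nonincreasing function. *)
Lemma lip_measurable (R : realType) (L : R) (v : R -> R) :
  one_sided_lip L v -> measurable_fun [set: R] v.
Proof.
move=> vL; rewrite (_ : v = (fun x => v x - L * x) \+ (fun x => L * x)); last first.
  by apply/funext => x /=; rewrite subrK.
apply: measurable_funD; last exact: mulrl_measurable.
apply: nonincreasing_measurable => //.
move=> x y; rewrite le_eqVlt => /predU1P[->//|xy].
by have := vL _ _ xy; lra.
Qed.

Lemma lip_completed_measurable (R : realType) (L : R) (v : R -> R) :
  one_sided_lip L v ->
  measurable_fun [set: caratheodory_type (@wlength R idfun)^*%mu] v.
Proof.
move=> /lip_measurable mv _ Y mY; apply: sub_caratheodory.
exact: mv.
Qed.

Lemma meas_setT (R : realType) : meas [set: R] = +oo%E.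
Proof.
by rewrite -[LHS]/(lebesgue_measure [set: R]) -set_itvNyy lebesgue_measure_itv.
Qed.

Lemma L1_perturbation (R : realType) (L T : R) (u s : R -> R) :
  L1 u -> one_sided_lip L s -> (TotVar s <= T%:E)%E ->
  (meas [set x | u x <> s x] < +oo)%E -> L1 s.
Proof.
move=> /Lfun1_integrable iu sL sT us; apply/Lfun1_integrable.
apply: (@integrable_perturbation _ _ _ _ _ _ (`|s 0| + T) iu _ _ us).
  exact: lip_completed_measurable sL.
move=> x; have := TotVar_osc x 0 sT.
have := ler_normD (s 0) (s x - s 0); rewrite addrC subrK; lra.
Qed.

(** If [|f x| > T], then [|f|] stays above the positive constant [|f x| - T] on the whole line,
    contradicting integrability. *)
Lemma L1_TotVar_bound (R : realType) (T x : R) (f : R -> R) :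
  L1 f -> (TotVar f <= T%:E)%E -> `|f x| <= T.
Proof.
move=> /Lfun1_integrable fi fT; rewrite leNgt; apply/negP => Tx.
apply: (integrable_not_bounded_below (meas_setT R) fi (c := `|f x| - T)).
  by rewrite subr_gt0.
move=> y; have := TotVar_osc x y fT.
have := ler_normD (f y) (f x - f y); rewrite addrC subrK; lra.
Qed.

(** * The two implications *)

Lemma powR2_natM (R : realType) (a : R) (n : nat) :
  2 `^ (a * n%:R) = (2 `^ a) ^+ n.
Proof. by rewrite powRrM powR_mulrn// powR_ge0. Qed.

Lemma powR_half_expr (R : realType) (a : R) (n : nat) :
  (2 ^- n) `^ a = (2 `^ (- a)) ^+ n.
Proof.
by rewrite -powR2_natM -powR_invn// -powRrM mulrC mulrN mulNr.
Qed.

Lemma powR2_gt1 (R : realType) (a : R) : 0 < a -> 1 < 2 `^ a.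
Proof.
move=> a0; rewrite -[ltLHS](powRr0 2) /powR pnatr_eq0/= ltr_expR.
by rewrite ltr_pM2r ?ln_gt0// ltr1n.
Qed.

Lemma powR2_lt1 (R : realType) (a : R) : 0 < a -> 2 `^ (- a) < 1.
Proof. by move=> a0; rewrite powRN invf_lt1 ?powR2_gt1// powR_gt0. Qed.

Lemma dyadic_scale (R : realType) (l : R) : 0 < l -> l <= 1 ->
  exists n : nat, 2 ^- n.+1 < l <= 2 ^- n.
Proof.
move=> l0 l1; have ex : exists n : nat, 2 ^- n.+1 < l.
  have : (2^-1 : R) ^+ n @[n --> \oo] --> 0 by apply: cvg_expr; rewrite gtr0_norm; lra.
  move=> /cvgrPdist_lt /(_ _ l0)[m _ /(_ m.+1 (leqnSn _))].
  rewrite sub0r normrN ger0_norm ?exprn_ge0 ?invr_ge0// exprVn => h.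
  by exists m.
exists (ex_minn ex); case: ex_minnP => n -> nmin /=.
case: n nmin => [_|n nmin]; first by rewrite expr0 invr1.
by rewrite leNgt; apply/negP => /nmin; rewrite ltnn.
Qed.

Lemma Pnorm_ge0 (R : realType) (alpha : R) (u : R -> R) : (0 <= Pnorm alpha u)%E.
Proof.
apply: (@le_trans _ _ (dlambda alpha 1 u)); last first.
  by apply: ereal_sup_ubound; exists 1 => //=; rewrite in_itv/= ltr01 lexx.
by apply: le_ereal_inf_tmp => _ [C [C0 _] <-]; rewrite lee_fin.
Qed.

Lemma Pnorm_approx (R : realType) (alpha M l : R) (u : R -> R) :
  (Pnorm alpha u < M%:E)%E -> 0 < l -> l <= 1 ->
  exists f : R -> R, [/\ L1 f,
    (TotVar f <= (M * l `^ (alpha - 1))%:E)%E &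
    (meas [set x | u x <> f x] <= (M * l `^ alpha)%:E)%E].
Proof.
move=> uM l0 l1.
have /ereal_inf_lt[_ [C [C0 [f [f1 fT fm]]] <-]] : (dlambda alpha l u < M%:E)%E.
  apply: le_lt_trans uM; apply: ereal_sup_ubound.
  by exists l => //=; rewrite in_itv/= l0.
rewrite lte_fin => /ltW CM; exists f; split => //.
- by apply: le_trans fT _; rewrite lee_fin ler_wpM2r ?powR_ge0.
- by apply: le_trans fm _; rewrite lee_fin ler_wpM2r ?powR_ge0.
Qed.

Lemma telescope_layers (R : realType) (S : nat -> R -> R) n x :
  \sum_(0 <= k < n.+1) (if k is m.+1 then S m.+1 \- S m else S 0%N) x = S n x.
Proof.
elim: n => [|n ih]; first by rewrite big_nat1.
by rewrite big_nat_recr//= ih addrC subrK.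
Qed.

(** At scale [1] and cost [2 ^- n], the approximation is bounded by [2 ^- n], so [{|u| > 2 ^- n}]
    has measure at most [2 ^- n]; Borel-Cantelli concludes. *)
Lemma Pnorm_eq0_ae (R : realType) (alpha : R) (u : R -> R) :
  (Pnorm alpha u = 0)%E -> {ae @completed_lebesgue_measure R, forall x, u x = 0}.
Proof.
move=> u0; pose A n := [set x | (2^-1 : R) ^+ n < `|u x|].
have h2 n : 0 < (2^-1 : R) ^+ n by rewrite exprn_gt0.
have mA n : (meas (A n) <= (1 * 2^-1 ^+ n)%:E)%E.
  have [|f [f1 fT fm]] := @Pnorm_approx _ alpha (2^-1 ^+ n) 1 u _ ltr01 (lexx _).
    by rewrite u0 lte_fin.
  rewrite mul1r; rewrite powR1 mulr1 in fT fm.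
  apply: le_trans fm; apply: meas_le => x /= uA uf.
  by move: uA; rewrite /A/= uf ltNge (L1_TotVar_bound x f1 fT).
have h0 : 0 < (2^-1 : R) by rewrite invr_gt0.
have h1 : (2^-1 : R) < 1 by rewrite invf_lt1// ltr1n.
have := ae_eventually_notin ler01 h0 h1 mA.
apply: negligibleS => x /= ux hA; apply: ux; apply/eqP; rewrite -normr_le0.
have : (2^-1 : R) ^+ n @[n --> \oo] --> 0 by apply: cvg_expr; rewrite gtr0_norm; lra.
move=> c; rewrite -(cvg_lim _ c)//; apply: limr_ge; first exact: cvgP c.
by apply: filterS hA => n /negP; rewrite -leNgt.
Qed.

Lemma layer_decomposition0 (R : realType) (alpha : R) (k : nat) :
  layer_decomposition alpha 0 k (cst 0) (fun _ => cst 0 : R -> R).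
Proof.
have s0 : supp (cst 0 : R -> R) = set0.
  rewrite /supp (_ : [set _ | _] = set0) ?closure0//.
  by apply/seteqP; split => // x /=.
split=> [x|p _ x1 x2 x12|i j _ _|p _ x|].
- by apply: cvg_near_cst; apply: nearW => n; rewrite big1.
- by rewrite subrr mulr_ge0 ?exprn_ge0// subr_ge0 ltW.
- by rewrite s0 interior0 => -[x []].
- by rewrite s0.
- rewrite mul0r eseries0// => n _ _; by rewrite s0 measure0.
Qed.

Lemma layer_decomposition_exists (R : realType) (alpha C : R) (k : nat) (v : R -> R) :
  one_sided_lip (2 ^+ k) v ->
  (meas [set x | v x <> 0%R] <= (C * 2 `^ (- alpha * k%:R))%:E)%E ->
  exists vp, layer_decomposition alpha C k v vp.
Proof.
move=> vL mv; have [||vp [h1 h2 h3 h4 h5]] := component_decomposition _ vL.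
- by rewrite exprn_gt0.
- by apply: le_lt_trans mv _; rewrite ltry.
exists vp; split => //; exact: le_trans h5 mv.
Qed.

(** For [2 ^- n.+1 < l <= 2 ^- n], the competitor at scale [l] is the sum of layers [0] to [n]: its
    variation is a geometric sum dominated by [p ^+ n], and the later layers live on a set of
    measure of order [q ^+ n.+1]. *)
Lemma layers_Pnorm_lty (R : realType) (alpha C : R) (u : R -> R)
    (v : nat -> R -> R) :
  0 < alpha -> alpha < 1 -> L1 u ->
  {ae @completed_lebesgue_measure R, forall x : R,
    \sum_(0 <= k < n) v k x @[n --> \oo] --> u x} ->
  (TotVar (v 0%N) <= C%:E)%E ->
  (forall k : nat, (1 <= k)%N ->
    (TotVar (v k) <= (C * 2 `^ ((1 - alpha) * k%:R))%:E)%E) ->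
  (forall k : nat, (1 <= k)%N ->
    (meas [set x | v k x <> 0%R] <= (C * 2 `^ (- alpha * k%:R))%:E)%E) ->
  (forall k : nat, one_sided_lip (2 ^+ k) (v k)) ->
  (Pnorm alpha u < +oo)%E.
Proof.
move=> a0 a1 u1 uv TV0 TVv mv vL.
have C0 : 0 <= C by rewrite -lee_fin; exact: le_trans (TotVar_ge0 _) TV0.
pose p := 2 `^ (1 - alpha) : R; pose q := 2 `^ (- alpha) : R.
have p1 : 1 < p by rewrite powR2_gt1// subr_gt0.
have q0 : 0 < q by rewrite powR_gt0.
have q1 : q < 1 by rewrite powR2_lt1.
have p0 : 0 < p by rewrite powR_gt0.
have Cp0 : 0 <= C * (p / (p - 1)).
  by rewrite mulr_ge0// divr_ge0 ?(ltW p0)//; lra.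
have Cq0 : 0 <= C / (1 - q) by rewrite divr_ge0//; lra.
pose K := Num.max (C * (p / (p - 1))) (C / (1 - q)).
have K0 : 0 <= K by rewrite le_max Cp0.
apply: (@le_lt_trans _ _ K%:E); last exact: ltry.
apply: ge_ereal_sup => _ [l /= + <-]; rewrite in_itv/= => /andP[l0 l1].
have [n /andP[nl ln]] := dyadic_scale l0 l1.
apply: ereal_inf_lbound; exists K => //; split => //.
pose s x := \sum_(k < n.+1) v k x.
have TVs : (TotVar s <= (C * (p / (p - 1)) * p ^+ n)%:E)%E.
  apply: (@le_trans _ _ (\sum_(k < n.+1) C * p ^+ k)%R%:E).
    apply: (@TotVar_sum _ v (fun k => C * p ^+ k)) => -[_|k _]; first by rewrite expr0 mulr1.
    by rewrite -powR2_natM TVv.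
  by rewrite -mulr_sumr lee_fin -mulrA ler_wpM2l// sum_expr_le.
have ms : (meas [set x | u x <> s x] <= (C / (1 - q) * q ^+ n.+1)%:E)%E.
  apply: (@le_trans _ _ (meas ([set x | ~ (\sum_(0 <= k < n) v k x @[n --> \oo] --> u x)]
      `|` \bigcup_(k in ~` `I_n.+1) [set x | v k x <> 0]))).
    apply: meas_le => x /= us; apply: contrapT => /not_orP[/contrapT cu h].
    suff cs : \sum_(0 <= k < n) v k x @[n --> \oo] --> s x.
      by apply: us; rewrite -(cvg_lim _ cu)// (cvg_lim _ cs).
    apply: cvg_near_cst; exists n.+1 => // m /= nm.
    rewrite (@big_cat_nat _ _ _ n.+1)//= big_mkord [X in _ + X]big_nat [X in _ + X]big1 ?addr0//.
    move=> k /andP[nk _]; apply: contrapT => vk; apply: h; exists k => //=.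
    by apply/negP; rewrite -leqNgt.
  apply: le_trans (meas_setU _ _) _; rewrite (negligible_meas_null uv) add0e.
  apply: meas_tail_geometric => // k nk.
  by rewrite -powR2_natM mv// (leq_trans _ nk).
(* This bound serves to make [s] measurable, hence integrable. *)
have sL : one_sided_lip (\sum_(k < n.+1) 2 ^+ k) s.
  by apply: (@one_sided_lip_sum _ (fun k => 2 ^+ k)).
exists s; split.
- by apply: (L1_perturbation u1 sL TVs); apply: le_lt_trans ms _; rewrite ltry.
- apply: le_trans TVs _; rewrite lee_fin.
  rewrite ler_pM ?exprn_ge0 ?(ltW p0)//; first by rewrite le_max lexx.
  rewrite (_ : p ^+ n = (2 ^- n) `^ (alpha - 1)); last first.
    by rewrite powR_half_expr opprB.
  (* The exponent [alpha - 1] is negative, so [l <= 2 ^- n] gives the inequality for the variation;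
     the lower bound on [l] serves for the measure. *)
  rewrite -(opprB 1 alpha) !powRN lef_pV2 ?posrE ?powR_gt0 ?invr_gt0 ?exprn_gt0//.
  by rewrite ge0_ler_powR ?nnegrE ?invr_ge0 ?exprn_ge0 ?(ltW l0)//; lra.
- apply: le_trans ms _; rewrite lee_fin.
  rewrite ler_pM ?exprn_ge0 ?(ltW q0)//; first by rewrite le_max lexx orbT.
  by rewrite -powR_half_expr ge0_ler_powR ?nnegrE ?invr_ge0 ?exprn_ge0 ?(ltW l0) ?(ltW nl)// ltW.
Qed.

Lemma layers_exist (R : realType) (alpha : R) : 0 < alpha -> alpha < 1 ->
  exists2 K : R, 0 < K & forall (u : R -> R) (M : R), (Pnorm alpha u < M%:E)%E ->
  exists v : nat -> R -> R,
  [/\ {ae @completed_lebesgue_measure R, forall x : R,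
        \sum_(0 <= k < n) v k x @[n --> \oo] --> u x},
      forall k, (TotVar (v k) <= (K * M * 2 `^ ((1 - alpha) * k%:R))%:E)%E,
      forall k, (1 <= k)%N ->
        (meas [set x | v k x <> 0%R] <= (K * M * 2 `^ (- alpha * k%:R))%:E)%E &
      forall k, one_sided_lip (2 ^+ k) (v k)].
Proof.
move=> a0 a1; pose p := 2 `^ (1 - alpha) : R; pose q := 2 `^ (- alpha) : R.
have p1 : 1 < p by rewrite powR2_gt1// subr_gt0.
have p0 : 0 < p by rewrite powR_gt0.
have q0 : 0 < q by rewrite powR_gt0.
have q1 : q < 1 by rewrite powR2_lt1.
have pq : p = 2 * q by rewrite /p powRD ?pnatr_eq0 ?implybT// powRr1.
have pV1 : p^-1 < 1 by rewrite invf_lt1.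
have pV0 : 0 < p^-1 by rewrite invr_gt0.
(* The midpoint of [p^-1] and [1], so that both [b < 1] and [p * b > 1]. *)
pose b := (1 + p^-1) / 2.
have b0 : 0 < b by rewrite /b; lra.
have b1 : b < 1 by rewrite /b; lra.
have pb1 : 1 < p * b.
  by rewrite (_ : p * b = (p + 1) / 2); [lra|rewrite /b; field; rewrite gt_eqF].
pose a := 6 * p / (p - 1); pose d := 1 + 6 / ((1 - b) * (1 - (p * b)^-1)).
have a_gt0 : 0 < a by rewrite divr_gt0 ?mulr_gt0// subr_gt0.
have d_gt0 : 0 < d.
  by rewrite addr_gt0// divr_gt0// mulr_gt0// subr_gt0// invf_lt1// (lt_trans ltr01).
have dq0 : 0 < d * (1 + q^-1) by rewrite mulr_gt0// addr_gt0// invr_gt0.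
(* The first term bounds the variation of a difference of two partial sums; the second bounds the
   union of their exceptional sets, since [q ^+ k = q^-1 * q ^+ k.+1]. *)
exists (2 * a + d * (1 + q^-1)); first by rewrite addr_gt0// mulr_gt0.
move=> u M uM.
have M0 : 0 <= M by rewrite -lee_fin; exact: le_trans (Pnorm_ge0 _ _) (ltW uM).
have /boolp.choice[f fP] k : exists f : R -> R,
    (TotVar f <= (M * p ^+ k)%:E)%E /\
    (meas [set x | u x <> f x] <= (M * q ^+ k)%:E)%E.
  have [||f [_ fT fm]] := @Pnorm_approx _ alpha M (2 ^- k) u uM.
  - by rewrite invr_gt0 exprn_gt0.
  - by rewrite invf_le1 ?exprn_gt0// exprn_ege1// ler1n.
  exists f; rewrite powR_half_expr opprB in fT; rewrite powR_half_expr in fm.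
  by split.
have [S [TVS mS S0 SS]] := one_sided_partial_sums p1 pq q1 b0 b1 pb1 M0
  (fun k => (fP k).1) (fun k => (fP k).2).
have pM n : 0 <= M * p ^+ n by rewrite mulr_ge0// exprn_ge0// ltW.
have qM n : 0 <= M * q ^+ n by rewrite mulr_ge0// exprn_ge0// ltW.
exists (fun k => if k is m.+1 then S m.+1 \- S m else S 0%N); split.
- have dM : 0 <= d * M by rewrite mulr_ge0// ltW.
  have := ae_eventually_notin dM q0 q1 mS.
  apply: negligibleS => x /= nu hA; apply: nu; apply: cvg_near_cst.
  case: hA => N _ hN; exists N.+1 => // -[//|n] /= Nn.
  by rewrite telescope_layers; have /contrapT := hN n Nn.
- move=> k; rewrite powR2_natM -/p.
  apply: (@le_trans _ _ (2 * a * (M * p ^+ k))%:E); last first.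
    by rewrite lee_fin -[leRHS]mulrA ler_wpM2r// lerDl ltW.
  case: k => [|k].
    apply: le_trans (TVS 0%N) _; rewrite lee_fin -/a -mulrA.
    by rewrite ler_wpM2r// ler_peMl ?(ltW a_gt0)// ler1n.
  rewrite -mulrA mulr2n mulrDl mul1r; apply: TotVarB.
    by rewrite mulrA; exact: TVS.
  apply: le_trans (TVS k) _; rewrite lee_fin -/a -mulrA ler_wpM2l ?(ltW a_gt0)//.
  by rewrite exprS mulrCA ler_peMl// ltW.
- move=> [//|k] _; rewrite powR2_natM -/q.
  apply: (@le_trans _ _ (d * (1 + q^-1) * (M * q ^+ k.+1))%:E); last first.
    by rewrite lee_fin -[leRHS]mulrA ler_wpM2r// lerDr mulr_ge0// ltW.
  apply: (@le_trans _ _ (meas ([set x | u x <> S k.+1 x] `|` [set x | u x <> S k x]))).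
    apply: meas_le => x /= SSx; apply: contrapT => /not_orP[/contrapT h1 /contrapT h2].
    by apply: SSx; rewrite -h1 -h2 subrr.
  apply: le_trans (meas_setU _ _) _.
  apply: le_trans (leeD (mS k.+1) (mS k)) _.
  rewrite -EFinD lee_fin -/d le_eqVlt; apply/orP; left; apply/eqP.
  by rewrite exprS; field; rewrite gt_eqF.
- by case=> [|k]; [rewrite expr0|exact: SS].
Qed.

Theorem theorem5p1 (R : realType) (alpha : R) (halpha0 : 0 < alpha)
    (halpha1 : alpha < 1) :
  exists K : R, 0 < K /\
    forall u : R -> R, L1 u -> Linfty u ->
      (Pclass alpha u <->
       exists (v : nat -> R -> R) (C : R),
         [/\ {ae @completed_lebesgue_measure R, forall x : R,
                \sum_(0 <= k < n) v k x @[n --> \oo] --> u x},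
             (C%:E <= K%:E * Pnorm alpha u)%E,
             [/\ (TotVar (v 0%N) <= C%:E)%E,
                 (forall k : nat, (1 <= k)%N ->
                    (TotVar (v k) <= (C * 2 `^ ((1 - alpha) * k%:R))%:E)%E) &
                 (forall k : nat, (1 <= k)%N ->
                    (meas [set x | v k x <> 0%R]
                      <= (C * 2 `^ (- alpha * k%:R))%:E)%E)],
             (forall k : nat, one_sided_lip (2 ^+ k) (v k)) &
             (forall k : nat, (1 <= k)%N ->
                exists vp : nat -> R -> R,
                  layer_decomposition alpha C k (v k) vp)]).
Proof.
have [K K0 HK] := layers_exist halpha0 halpha1.
(* The factor [2] leaves room for near-optimal approximations: a positive finite norm is strictly
   below its double. *)
exists (2 * K); split; first by rewrite mulr_gt0.
move=> u u1 uoo; split; last first.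
  move=> [v [C [uv _ [TV0 TVv mv] vL _]]]; split => //.
  exact: layers_Pnorm_lty TVv mv vL.
move=> [_ _ uP]; have [u0|u0] := eqVneq (Pnorm alpha u) 0%E.
  (* A vanishing norm leaves no such room and forces [C <= 0]; here [u] vanishes almost everywhere
     and zero layers suffice. *)
  exists (fun=> cst 0), 0; split.
  - have := Pnorm_eq0_ae u0; apply: negligibleS => x /= h ux; apply: h.
    by rewrite ux; apply: cvg_near_cst; apply: nearW => n; rewrite big1.
  - by rewrite u0 mule0.
  - split => [|k _|k _]; rewrite ?TotVar_cst ?mul0r//.
    by rewrite (_ : mkset _ = set0) ?measure0//; apply/seteqP; split => // x /=.
  - by move=> k x1 x2 x12; rewrite subrr mulr_ge0 ?exprn_ge0// subr_ge0 ltW.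
  - by move=> k _; exists (fun=> cst 0); exact: layer_decomposition0.
have Pfin : Pnorm alpha u \is a fin_num by rewrite ge0_fin_numE// Pnorm_ge0.
pose M := fine (Pnorm alpha u).
have PM : Pnorm alpha u = M%:E by rewrite fineK.
have M0 : 0 < M by rewrite -lte_fin -PM lt_def u0 Pnorm_ge0.
have [|v [uv TVv mv vL]] := HK u (2 * M); first by rewrite PM lte_fin; lra.
exists v, (K * (2 * M)); split => //.
- by rewrite PM -EFinM lee_fin mulrCA mulrA.
- split=> [|k _|//]; last exact: TVv.
  by have := TVv 0%N; rewrite mulr0 powRr0 mulr1.
- move=> k k1; exact: layer_decomposition_exists (vL k) (mv k k1).
Qed.
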